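(* Let $\mathbb{T} = \{ T_n = \tfrac{n(n+1)}{2} : n \ge 1\}$ be the set of positive triangular numbers. If $f$ is a multiplicative function satisfying \[ f(a+b+c) = f(a)+f(b)+f(c) \] for all $a,b,c \in \mathbb{T}$, then $f$ is the identity function, i.e. $f(n)=n$ for all positive integers $n$.
   Context: A multiplicative function is a complex-valued function $f$ on the positive integers, not identically zero, with $f(mn)=f(m)f(n)$ whenever $\gcd(m,n)=1$. *)

(* Defs.v *)
From mathcomp Require Import all_boot all_order all_algebra.
From mathcomp Require Import complex reals.

Set Implicit Arguments.
Unset Strict Implicit.
Unset Printing Implicit Defensive.

Local Open Scope ring_scope.

(* Arithmetic functions are represented as functions on [nat] whose value at 0
   is irrelevant: every condition below is restricted to positive arguments
   (the restriction matters, since [coprime 0 1] holds). *)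
Definition multiplicative_function (R : realType) (f : nat -> R[i]) : Prop :=
  (exists2 n : nat, (0 < n)%N & f n <> 0) /\
  (forall m n : nat, (0 < m)%N -> (0 < n)%N -> coprime m n ->
     f (m * n)%N = f m * f n).

Definition triangular (n : nat) : nat := ((n * (n + 1)) %/ 2)%N.

Definition positive_triangular (a : nat) : Prop :=
  exists2 n : nat, (1 <= n)%N & a = triangular n.

(* Main.v *)
Require Import Defs.
From mathcomp Require Import all_boot all_order all_algebra.
From mathcomp Require Import complex reals.
From mathcomp Require Import ring zify.

(** Write [T_n] for the triangular numbers. If [T_a + T_b = T_c + T_d], adding
    [1] to both sides gives [f T_a + f T_b = f T_c + f T_d]. In terms of the odd
    numbers [2 n + 1] such relations are equalities between sums of two squares,
    and [(2x+y)^2 + (x-2y)^2 = (2x-y)^2 + (x+2y)^2] with [x = 2k+1] and [y = 1, 3]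
    expresses [f T_(2k+1)] and [f T_(2k+2)] through earlier values. As [f] is
    the identity at [T_1, ..., T_9], it is so at every [T_n]. Finally
    [T_(2j+1) = (j+1) (2j+1)] passes from [j+1] to [2j+1], then from [2j+1] to
    [4j+1], and [T_(4j) = 2j (4j+1)] passes from there to [2j]. *)

Local Open Scope ring_scope.
Import GRing.Theory Num.Theory.

(** One of [n] and [n.+1] is even, so the halving is exact; later identities use this division-free
    form. *)
Lemma triangularE (n : nat) : (triangular n * 2 = n * n.+1)%N.
Proof. by rewrite /triangular divnK addn1// dvdn2 oddM /= andbN. Qed.

Section AdditiveOnTriangular.

Variables (R : realType) (f : nat -> R[i]).
Hypothesis f_mult : multiplicative_function f.
Hypothesis f_add : forall a b c : nat,
  positive_triangular a -> positive_triangular b -> positive_triangular c ->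
  f (a + b + c)%N = f a + f b + f c.

Let fM (m n : nat) : (0 < m)%N -> (0 < n)%N -> coprime m n ->
  f (m * n)%N = f m * f n.
Proof. by case: f_mult => _; apply. Qed.

Let fT (a b c : nat) : (0 < a)%N -> (0 < b)%N -> (0 < c)%N ->
  f (triangular a + triangular b + triangular c)%N =
  f (triangular a) + f (triangular b) + f (triangular c).
Proof. by move=> a0 b0 c0; apply: f_add; [exists a | exists b | exists c]. Qed.

Lemma f_1 : f 1 = 1.
Proof.
case: f_mult => -[n n0 /eqP fn0] _.
by apply: (mulfI fn0); rewrite -fM ?coprimen1// muln1 mulr1.
Qed.

Lemma f_3 : f 3 = 3.
Proof. by rewrite (fT 1 1 1)// f_1; ring. Qed.

Lemma f_5 : f 5 = 5.
Proof. by rewrite (fT 1 1 2)// f_1 f_3; ring. Qed.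

Lemma f_7 : f 7 = 7.
Proof. by rewrite (fT 1 2 2)// f_1 f_3; ring. Qed.

Lemma f_9 : f 9 = 9.
Proof. by rewrite (fT 2 2 2)// f_3; ring. Qed.

(* [5 f(2) = f(10) = f(1 + 3 + 6) = 4 + 3 f(2)]. *)
Lemma f_2 : f 2 = 2.
Proof.
have f10 : f 10 = f 1 + f 3 + f 6 by exact: (fT 1 2 3).
rewrite (fM 2 5)// (fM 2 3)// f_1 f_3 f_5 in f10.
have n2 : (2 : R[i]) != 0 by rewrite pnatr_eq0.
apply: (mulfI n2).
have -> : 2 * f 2 = f 2 * 5 - f 2 * 3 by ring.
by rewrite f10; ring.
Qed.

(** Evaluate [f 12] twice: [12 = 3 * 4] and [12 = 1 + 1 + 10], where [10 = 2 * 5]. *)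
Lemma f_4 : f 4 = 4.
Proof.
have f12 : f 12 = f 1 + f 1 + f 10 by exact: (fT 1 1 4).
rewrite (fM 3 4)// (fM 2 5)// f_1 f_2 f_3 f_5 in f12.
have n3 : (3 : R[i]) != 0 by rewrite pnatr_eq0.
by apply: (mulfI n3); rewrite f12; ring.
Qed.

(** From [6] to [45], each value splits into two coprime factors among 2, 3, 4, 5, 7, 9. *)
Lemma f_triangular_small (n : nat) : (0 < n < 10)%N ->
  f (triangular n) = (triangular n)%:R.
Proof.
case: n => [|[|[|[|[|[|[|[|[|[|n]]]]]]]]]]// _.
- exact: f_1.
- exact: f_3.
- by rewrite (fM 2 3)// f_2 f_3 -natrM.
- by rewrite (fM 2 5)// f_2 f_5 -natrM.
- by rewrite (fM 3 5)// f_3 f_5 -natrM.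
- by rewrite (fM 3 7)// f_3 f_7 -natrM.
- by rewrite (fM 4 7)// f_4 f_7 -natrM.
- by rewrite (fM 4 9)// f_4 f_9 -natrM.
- by rewrite (fM 5 9)// f_5 f_9 -natrM.
Qed.

Lemma f_triangular_exchange (a b c d : nat) :
  (0 < a)%N -> (0 < b)%N -> (0 < c)%N -> (0 < d)%N ->
  (triangular a + triangular b = triangular c + triangular d)%N ->
  f (triangular b) = (triangular b)%:R ->
  f (triangular c) = (triangular c)%:R ->
  f (triangular d) = (triangular d)%:R ->
  f (triangular a) = (triangular a)%:R.
Proof.
move=> a0 b0 c0 d0 eT fb fc fd.
have := fT a b 1 a0 b0 isT.
rewrite eT (fT c d 1)// fb fc fd => /addIr e.
by apply: (addIr (triangular b)%:R); rewrite -e -!natrD eT.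
Qed.

Lemma f_triangular (n : nat) : (0 < n)%N ->
  f (triangular n) = (triangular n)%:R.
Proof.
have [m] := ubnP n; elim: m n => // m IH n nm n0.
have [n10|n10] := ltnP n 10; first by apply: f_triangular_small; rewrite n0.
(* The bound on [k] keeps the index [k - 3] positive. *)
have [k [k4 [nE|nE]]] : exists k, (4 <= k)%N /\ (n = k.*2.+1 \/ n = k.*2.+2)%N.
  by exists n.-1./2; lia.
(* Case [y = 1]: [T_(2k+1) - T_(2k)] and [T_(k+1) - T_(k-1)] both equal [2k+1]. *)
- apply: (@f_triangular_exchange n k.-1 k.*2 k.+1); try (apply: IH); try lia.
  have := triangularE n; have := triangularE k.-1; have := triangularE k.*2.
  have := triangularE k.+1; nia.
(* Case [y = 3]: [T_(2k+2) - T_(2k-1)] and [T_(k+3) - T_(k-3)] both equal [6k+3]. *)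
- apply: (@f_triangular_exchange n (k - 3) k.*2.-1 (k + 3)); try (apply: IH); try lia.
  have := triangularE n; have := triangularE (k - 3).
  have := triangularE k.*2.-1; have := triangularE (k + 3); nia.
Qed.

(** Here [f m * f n = f (m * n) = m * n], and the nonzero factor [f m = m] cancels. *)
Lemma f_triangular_cofactor (m n t : nat) : (0 < m)%N -> (0 < n)%N ->
  (0 < t)%N -> coprime m n -> (m * n = triangular t)%N ->
  f m = m%:R -> f n = n%:R.
Proof.
move=> m0 n0 t0 mn mnE fm.
have m0' : (m%:R : R[i]) != 0 by rewrite pnatr_eq0 -lt0n.
by apply: (mulfI m0'); rewrite -{1}fm -fM// mnE f_triangular// -mnE natrM.
Qed.

Lemma f_double_succ (j : nat) : f j.+1 = j.+1%:R -> f j.*2.+1 = j.*2.+1%:R.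
Proof.
apply: (@f_triangular_cofactor _ _ j.*2.+1) => //.
  have -> : j.*2.+1 = (j.+1 + j)%N by lia.
  by rewrite /coprime gcdnDl -/(coprime _ _) coprimeSn.
by have := triangularE j.*2.+1; nia.
Qed.

Lemma f_double (j : nat) : (0 < j)%N -> f j.+1 = j.+1%:R ->
  f j.*2 = j.*2%:R.
Proof.
move=> j0 /f_double_succ/f_double_succ.
apply: (@f_triangular_cofactor _ _ j.*2.*2) => //; try lia.
  have -> : j.*2.*2.+1 = (j.*2 + j.*2.+1)%N by lia.
  by rewrite coprime_sym /coprime gcdnDl -/(coprime _ _) coprimenS.
by have := triangularE j.*2.*2; nia.
Qed.

Lemma f_id (n : nat) : (0 < n)%N -> f n = n%:R.
Proof.
have [m] := ubnP n; elim: m n => // m IH n nm n0.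
(* Writing [n] as [2j+1] or [2j], the descent to [j+1] is strict only from [n = 3] on. *)
have [n2|n2] := leqP n 2.
  by case: n n2 n0 {nm} => [|[|[|]]]// _ _; [exact: f_1 | exact: f_2].
have [nE|nE] : n = n./2.*2.+1 \/ n = n./2.*2 by lia.
- by rewrite nE; apply: f_double_succ; apply: IH; lia.
- by rewrite nE; apply: f_double; [lia | apply: IH; lia].
Qed.

End AdditiveOnTriangular.

Theorem theorem2p1 (R : realType) (f : nat -> R[i])
  (f_mult : multiplicative_function f)
  (f_add : forall a b c : nat,
     positive_triangular a -> positive_triangular b -> positive_triangular c ->
     f (a + b + c)%N = f a + f b + f c) :
  forall n : nat, (0 < n)%N -> f n = n%:R.
Proof. exact: f_id. Qed.
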